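(* Consider the Probabilistic Serial mechanism with $n$ agents and $m \le n$ items in the following dichotomous setting for agent 1. Agent 1 has a true strict linear order $\succ_1$ over the items; let $\overline{O}$ be the set of its $k$ most preferred items under $\succ_1$ (for some $1 \le k \le m$), and let agent 1's utility from an allocation be the total amount it receives of items in $\overline{O}$. Fix arbitrary reported strict linear orders of agents $2,\dots,n$. Let $u_1$ be agent 1's utility when it reports $\succ_1$, and let $T$ be the time at which the last item of $\overline{O}$ is exhausted in this truthful run. If $\tfrac12 \le T < \tfrac23$, then for every strict linear order $\succ'_1$ reported by agent 1, its resulting utility $u'_1$ satisfies $u'_1 \le \tfrac32 u_1$.
   Context: Probabilistic Serial: there are $n$ agents and $m$ divisible items of unit supply; each agent reports a strict linear order over all items. Starting at time $0$, every agent consumes at rate $1$ per unit time its most preferred item (according to its report) among those with positive remaining supply; when an item is exhausted, agents consuming it move to their most preferred item still available; this continues until all items are exhausted. Each agent's allocation is the amount of each item it consumed. (In the truthful run agent 1 eats only items of $\overline{O}$ until time $T$, so $u_1 = T$.) *)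

(* Defs.v *)
From mathcomp Require Import all_boot all_order fingroup perm all_algebra.
Set Implicit Arguments. Unset Strict Implicit. Unset Printing Implicit Defensive.
Import Order.TTheory GRing.Theory Num.Theory.
Local Open Scope ring_scope.

(* A strict linear order over the items 'I_m is encoded by a permutation
   [p : 'S_m] giving the rank of each item: [p j = 0] is the most preferred
   item, and j is preferred to j' iff (p j < p j')%N. *)

Definition top (m : nat) (p : 'S_m) (S : {set 'I_m}) : option 'I_m :=
  [pick j in S | [forall j' in S, (p j <= p j')%N]].

Record ps_state (R : realFieldType) (n m : nat) := PSState {
  st_time   : R;
  st_supply : 'I_m -> R;
  st_alloc  : 'I_n -> 'I_m -> R;
  st_extime : 'I_m -> R
}.

(* One phase of the eating process: every agent eats its most preferred
   available item at rate 1 until the first moment some item is exhausted. *)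
Definition ps_step (R : realFieldType) (n m : nat) (prof : 'I_n -> 'S_m)
    (st : ps_state R n m) : ps_state R n m :=
  let t := st_time st in
  let sup := st_supply st in
  let S := [set j | 0 < sup j] in
  let cnt j := #|[set a | top (prof a) S == Some j]| in
  let E := [set j in S | (0 < cnt j)%N] in
  let d := \big[Num.min/(\sum_(j in S) sup j)]_(j in E) (sup j / (cnt j)%:R) in
  let sup' j := sup j - (cnt j)%:R * d in
  @PSState R n m (t + d) sup'
    (fun a j => st_alloc st a j + (if top (prof a) S == Some j then d else 0))
    (fun j => if (j \in S) && (sup' j == 0) then t + d else st_extime st j).

Definition ps_init (R : realFieldType) (n m : nat) : ps_state R n m :=
  @PSState R n m 0 (fun _ => 1) (fun _ _ => 0) (fun _ => 0).

(* Each phase with items remaining (and n >= 1) exhausts at least one item,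
   so m phases finish the process; further phases are no-ops. *)
Definition ps_run (R : realFieldType) (n m : nat) (prof : 'I_n -> 'S_m)
  : ps_state R n m := iter m (ps_step prof) (ps_init R n m).

Definition ps_alloc (R : realFieldType) (n m : nat) (prof : 'I_n -> 'S_m)
  (a : 'I_n) (j : 'I_m) : R := st_alloc (ps_run R prof) a j.

Definition ps_extime (R : realFieldType) (n m : nat) (prof : 'I_n -> 'S_m)
  (j : 'I_m) : R := st_extime (ps_run R prof) j.

Definition deviate (n m : nat) (prof : 'I_n -> 'S_m) (i : 'I_n) (p : 'S_m)
  : 'I_n -> 'S_m := fun a => if a == i then p else prof a.

Definition dich_util (R : realFieldType) (n m : nat) (ptrue : 'S_m) (k : nat)
  (prof : 'I_n -> 'S_m) (i : 'I_n) : R :=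
  \sum_(j : 'I_m | (ptrue j < k)%N) ps_alloc R prof i j.

Definition last_ex_time (R : realFieldType) (n m : nat) (ptrue : 'S_m) (k : nat)
  (prof : 'I_n -> 'S_m) : R :=
  \big[Num.max/0]_(j : 'I_m | (ptrue j < k)%N) ps_extime R prof j.

(* Main.v *)
Require Import Defs.
From mathcomp Require Import all_boot all_order fingroup perm all_algebra.
From mathcomp Require Import lra.
Import Order.TTheory GRing.Theory Num.Theory.
Local Open Scope ring_scope.

(** The exhaustion times [e] of a run satisfy a static equation: agent [a] eats
    item [j] from the moment [start] at which the last item it prefers to [j] is
    gone until [e j], so the positive parts of [e j - start] sum to 1 over the
    agents.

    Compare the truthful run and the manipulated run with the run in which agent
    [i] is absent, where every item lasts at least as long as in either of them.
    At time [T] that run has eaten exactly [T] less than the truthful one, which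
    has exhausted Obar, so at most [T] of Obar remains, hence at most [T] remains
    in the manipulated run too.  As [T < 1], every item of Obar still left
    at time [T] is being eaten by some agent other than [i], so [i] gets at most
    half of what remains, and at most [T] before: [u' <= T + T / 2], while
    [u = T]. *)

(** * Eating intervals determined by a vector of exhaustion times *)

Definition start {R : realFieldType} {m : nat} (p : 'S_m) (f : 'I_m -> R)
    (j : 'I_m) : R :=
  \big[Num.max/0]_(j' : 'I_m | (p j' < p j)%N) f j'.

Definition eaten {R : realFieldType} {m : nat} (p : 'S_m) (f : 'I_m -> R)
    (j : 'I_m) : R :=
  Num.max 0 (f j - start p f j).

Definition exhaustion_times {R : realFieldType} {n m : nat}
    (prof : 'I_n -> 'S_m) (e : 'I_m -> R) : Prop :=
  (forall j, 0 <= e j) /\ (forall j, \sum_a eaten (prof a) e j = 1).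

Section Eaten.
Context {R : realFieldType} {m : nat}.
Implicit Types (p : 'S_m) (f g : 'I_m -> R) (j : 'I_m).

Lemma start_ge0 p f j : 0 <= start p f j.
Proof. exact: bigmax_ge_id. Qed.

Lemma le_start p f j j' : (p j' < p j)%N -> f j' <= start p f j.
Proof. by move=> lt_j'j; rewrite /start; apply: le_bigmax_cond. Qed.

Lemma start_le p f j x :
  0 <= x -> (forall j', (p j' < p j)%N -> f j' <= x) -> start p f j <= x.
Proof. by move=> x0 fx; apply: bigmax_le. Qed.

Lemma eaten_ge0 p f j : 0 <= eaten p f j.
Proof. by rewrite le_max lexx. Qed.

Lemma le_eaten p f j : f j - start p f j <= eaten p f j.
Proof. by rewrite le_max lexx orbT. Qed.

Lemma eaten_eq0 p f j : f j <= start p f j -> eaten p f j = 0.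
Proof. by move=> h; rewrite /eaten; apply: max_l; lra. Qed.

Lemma eaten_eq_sub p f j : start p f j <= f j -> eaten p f j = f j - start p f j.
Proof. by move=> h; rewrite /eaten; apply: max_r; lra. Qed.

Lemma eaten_le p f g j :
  start p g j <= start p f j -> f j <= g j -> eaten p f j <= eaten p g j.
Proof.
move=> hs hf; rewrite ge_max eaten_ge0 /=.
by apply: le_trans (le_eaten p g j); lra.
Qed.

(** Telescopes along the ranks: the item of rank [k] raises the running maximum by exactly what is
    eaten of it, as an agent never pauses. *)
Lemma sum_eaten p f (k : nat) : (k <= m)%N ->
  \sum_(j : 'I_m | (p j < k)%N) eaten p f j
    = \big[Num.max/0]_(j : 'I_m | (p j < k)%N) f j.
Proof.
elim: k => [|k IH] km; first by rewrite !big_pred0.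
pose j0 : 'I_m := (p^-1)%g (Ordinal km).
have pj0 : p j0 = k :> nat by rewrite /j0 permKV.
have Pj (j : 'I_m) : ((p j < k.+1)%N && (j != j0)) = (p j < k)%N.
  rewrite ltnS leq_eqVlt -{1}pj0 (inj_eq val_inj) (inj_eq perm_inj).
  by case: eqP => [->|] //=; rewrite ?andbT // pj0 ltnn.
rewrite (bigD1 j0) /= ?pj0 // (bigD1 (F := f) j0) /= ?pj0 //.
rewrite (eq_bigl _ _ Pj) (eq_bigl _ _ Pj) IH 1?ltnW //.
rewrite /eaten /start pj0; set M := \big[_/_]_(_ | _) _.
by case: (leP (f j0) M) => h; [rewrite max_l|rewrite max_r]; lra.
Qed.

Lemma sum_eatenT p f :
  \sum_j eaten p f j = \big[Num.max/0]_j f j.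
Proof.
have P (j : 'I_m) : true = (p j < m)%N by rewrite ltn_ord.
by rewrite (eq_bigl _ _ P) sum_eaten // -(eq_bigl _ _ P).
Qed.

Lemma start_min p f j T : 0 <= T ->
  start p (fun j' => Num.min T (f j')) j = Num.min T (start p f j).
Proof.
move=> T0; apply/eqP; rewrite eq_le; apply/andP; split.
  apply: start_le => [|j' lt_j'j]; first by rewrite le_min T0 start_ge0.
  by rewrite le_min ge_min lexx /= ge_min (le_start p f j j' lt_j'j) orbT.
have [h|h] := leP (start p f j) T.
  apply: start_le => [|j' lt_j'j]; first exact: start_ge0.
  have := le_start p (fun j' => Num.min T (f j')) j j' lt_j'j.
  by rewrite /= min_r // (le_trans (le_start p f j j' lt_j'j) h).
rewrite leNgt; apply/negP => h'; move: h; rewrite ltNge => /negP; apply.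
apply: start_le => // j' lt_j'j; rewrite leNgt; apply/negP => h.
have := le_start p (fun j' => Num.min T (f j')) j j' lt_j'j.
by rewrite /= min_l ?(ltW h) // => /(lt_le_trans h'); rewrite ltxx.
Qed.

(** Truncating [f] at [T] describes consumption up to time [T]. The start itself may stay
    untruncated: once it exceeds [T], both sides vanish. *)
Lemma eaten_min p f j T : 0 <= T ->
  eaten p (fun j' => Num.min T (f j')) j
    = Num.max 0 (Num.min T (f j) - start p f j).
Proof.
move=> T0; rewrite /eaten start_min //.
have [h|h] := leP (start p f j) T => //.
have hT : Num.min T (f j) <= T by rewrite ge_min lexx.
by rewrite !max_l //; lra.
Qed.

Lemma topP p (S : {set 'I_m}) j :
  reflect (j \in S /\ forall j', j' \in S -> (p j <= p j')%N)
          (top p S == Some j).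
Proof.
rewrite /top; case: pickP => [x /andP [xS /forall_inP xmin]|none].
  apply: (iffP eqP) => [[<-] //|[jS jmin]].
  congr Some; apply/(@perm_inj _ p)/val_inj/eqP.
  by rewrite eqn_leq xmin //= jmin.
constructor=> -[jS jmin]; move: (none j); rewrite jS /=.
by move/negbT/negP; apply; apply/forall_inP.
Qed.

Lemma top_ex p (S : {set 'I_m}) j : j \in S -> exists j', top p S == Some j'.
Proof.
move=> jS; case: (arg_minnP (fun j => p j) jS) => j0 j0S j0min.
by exists j0; apply/topP.
Qed.

(** One phase prolongs every item of [S] to [t + d]. An item behind a member of [S] stays uneaten,
    its start moving along; only the top of [S] gains [d]. *)
Lemma eaten_advance p f (S : {set 'I_m}) t d j : 0 <= d ->
  (forall j, 0 <= f j <= t) -> (forall j, j \in S -> f j = t) ->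
  eaten p (fun j' => if j' \in S then t + d else f j') j
    = eaten p f j + (if top p S == Some j then d else 0).
Proof.
move=> d0 fb fS; set f' := fun _ => _.
have ff' j' : f j' <= f' j' by rewrite /f'; case: ifP => [/fS|] //; lra.
have sle : start p f j <= start p f' j.
  apply: start_le => [|j' h]; first exact: start_ge0.
  exact: le_trans (ff' j') (le_start p f' j j' h).
have [h|h] := boolP [forall j' in S, ~~ (p j' < p j)%N]; last first.
  have [j1 j1S lt1] : exists2 j1, j1 \in S & (p j1 < p j)%N.
    by move: h => /forall_inPn [j1 ? /negPn]; exists j1.
  case: topP => [[_ /(_ j1 j1S)]|_]; first by rewrite leqNgt lt1.
  rewrite addr0 !eaten_eq0 //.
    apply: le_trans (le_start p f j j1 lt1).
    by rewrite (fS j1 j1S); case/andP: (fb j).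
  apply: le_trans (le_start p f' j j1 lt1); rewrite /f' j1S.
  by case: ifP => // _; case/andP: (fb j) => _; lra.
move/forall_inP: h => h.
have eqs : start p f' j = start p f j.
  by apply: eq_bigr => j' lt; rewrite /f'; case: ifP => // /h; rewrite lt.
have sf : j \in S -> start p f j <= f j.
  move=> jS; rewrite fS //; case/andP: (fb j) => f0 ft.
  apply: start_le => [|j' _]; first exact: le_trans ft.
  by case/andP: (fb j').
case: topP => [[jS _]|notop].
  have Ef' : f' j = f j + d by rewrite /f' jS fS.
  have h1 := sf jS; rewrite eaten_eq_sub ?eqs ?Ef'; last lra.
  by rewrite eaten_eq_sub //; lra.
have jS : j \notin S.
  apply/negP => jS; apply: notop; split=> // j' j'S.
  by rewrite leqNgt h.
by rewrite addr0 /eaten eqs /f' (negPf jS).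
Qed.

End Eaten.

(** * From the eating process to the static equation *)

(* The exhaustion time truncated at the current time; [st_extime] is still the
   junk value 0 for available items. *)
Definition clock {R : realFieldType} {n m : nat} (st : ps_state R n m)
    (j : 'I_m) : R :=
  if 0 < st_supply st j then st_time st else st_extime st j.

Definition ps_inv {R : realFieldType} {n m : nat} (prof : 'I_n -> 'S_m)
    (st : ps_state R n m) : Prop :=
  [/\ forall j, 0 <= st_supply st j,
      forall j, 0 <= clock st j <= st_time st,
      forall a j, st_alloc st a j = eaten (prof a) (clock st) j &
      forall j, st_supply st j + \sum_a st_alloc st a j = 1].

Lemma ps_inv_init (R : realFieldType) (n m : nat) (prof : 'I_n -> 'S_m) :
  ps_inv prof (ps_init R n m).
Proof.
split=> [j|j|a j|j] /=; rewrite /clock /= ?ltr01 ?lexx ?ler01 //.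
  by rewrite eaten_eq0 //= start_ge0.
by rewrite big1 ?addr0.
Qed.

(** An item attaining the minimum [d] runs out, so availability strictly shrinks; the predecessor
    also covers the case of no item left. *)
Lemma ps_inv_step (R : realFieldType) (n m : nat) (prof : 'I_n -> 'S_m)
    (st : ps_state R n m) (S := [set j | 0 < st_supply st j])
    (S' := [set j | 0 < st_supply (ps_step prof st) j]) :
  (0 < n)%N -> ps_inv prof st ->
  ps_inv prof (ps_step prof st) /\ (#|S'| <= #|S|.-1)%N.
Proof.
move=> n0 [sup0 clk alc cons].
pose cnt j := #|[set a | top (prof a) S == Some j]|.
pose E := [set j in S | (0 < cnt j)%N].
pose d := \big[Num.min/(\sum_(j in S) st_supply st j)]_(j in E)
  (st_supply st j / (cnt j)%:R).
pose sup' j := st_supply st j - (cnt j)%:R * d.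
have supE j : st_supply (ps_step prof st) j = sup' j by [].
have timE : st_time (ps_step prof st) = st_time st + d by [].
have allE a j : st_alloc (ps_step prof st) a j =
  st_alloc st a j + (if top (prof a) S == Some j then d else 0) by [].
have exE j : st_extime (ps_step prof st) j =
  if (j \in S) && (sup' j == 0) then st_time st + d else st_extime st j by [].
have inS j : (j \in S) = (0 < st_supply st j) by rewrite inE.
have sup_out j : j \notin S -> st_supply st j = 0.
  by rewrite inS -leNgt => h; apply/eqP; rewrite eq_le h sup0.
have cnt_out j : j \notin S -> cnt j = 0%N.
  move=> jS; apply/eqP; rewrite cards_eq0; apply/eqP/setP => a.
  by rewrite !inE; apply/topP => -[]; rewrite (negPf jS).
have cntE j : \sum_a (if top (prof a) S == Some j then d else 0)
    = (cnt j)%:R * d.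
  rewrite -big_mkcond /= mulr_natl -sumr_const.
  by apply: eq_bigl => a; rewrite inE.
have d0 : 0 <= d.
  apply/bigmin_geP; split=> [|j _]; first exact: sumr_ge0.
  by rewrite divr_ge0.
have supS j : j \in S -> 0 <= sup' j.
  move=> jS; rewrite subr_ge0; have [->|c0] := posnP (cnt j).
    by rewrite mul0r.
  rewrite mulrC -ler_pdivlMr ?ltr0n //.
  by apply: bigmin_le_cond; rewrite inE jS.
have sup'_out j : j \notin S -> sup' j = 0.
  by move=> jS; rewrite /sup' cnt_out // sup_out // mul0r subr0.
have clkE j : clock (ps_step prof st) j =
    if j \in S then st_time st + d else clock st j.
  rewrite /clock supE timE exE -inS; have [jS|jS] := boolP (j \in S).
    have [-> //|sneq] := eqVneq (sup' j) 0; first by rewrite ltxx.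
    by rewrite lt_neqAle eq_sym sneq supS.
  by rewrite sup'_out // ltxx.
split; first split.
- move=> j; rewrite supE; have [/supS//|jS] := boolP (j \in S).
  by rewrite sup'_out.
- move=> j; rewrite clkE timE; case/andP: (clk j) => c0 ct.
  by case: ifP => _; apply/andP; split; lra.
- move=> a j; rewrite allE alc -(@eaten_advance _ _ _ _ _ (st_time st)) //.
    rewrite /eaten clkE; congr (Num.max 0 (_ - _)).
    by apply: eq_bigr => j' _; rewrite clkE.
  by move=> j'; rewrite inS /clock => ->.
- move=> j; rewrite supE -(cons j) (eq_bigr _ (fun a _ => allE a j)).
  by rewrite big_split /= cntE /sup'; lra.
have S'S : S' \subset S.
  apply/subsetP => j; rewrite !inE supE; apply: contraTT.
  by rewrite -inS => /sup'_out ->; rewrite ltxx.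
have [S0|[j1 j1S]] := set_0Vmem S.
  by rewrite S0 subset0 in S'S; rewrite (eqP S'S) S0 cards0.
have [j2 j2top] := top_ex (prof (Ordinal n0)) S j1 j1S.
have j2E : j2 \in E.
  case/topP: (j2top) => j2S _; rewrite inE j2S card_gt0.
  by apply/set0Pn; exists (Ordinal n0); rewrite inE.
(* The default of the minimum, the total supply, is at least every ratio, so [d] is attained in the
   nonempty set [E]. *)
have le_sum j : j \in E -> st_supply st j / (cnt j)%:R <= \sum_(j in S) st_supply st j.
  rewrite inE => /andP [jS c0]; rewrite (bigD1 j) //= ler_wpDr ?sumr_ge0 //.
  by rewrite ler_pdivrMr ?ltr0n // ler_peMr // ler1n.
have [j0 j0E dE] := eq_bigmin j2 _ _ j2E le_sum.
have {}j0E : j0 \in E by [].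
move: (j0E); rewrite inE => /andP [j0S c0].
have j0S' : j0 \notin S'.
  rewrite inE supE /sup' /d dE mulrC divfK ?subrr ?ltxx //.
  by rewrite pnatr_eq0 -lt0n.
rewrite -ltnS prednK ?card_gt0; last by apply/set0Pn; exists j0.
apply: proper_card; apply/properP; split=> //; by exists j0.
Qed.

(** After [m] phases nothing is available: [clock] is then the exhaustion time, and conservation
    becomes the static equation. *)
Lemma ps_run_spec (R : realFieldType) (n m : nat) (prof : 'I_n -> 'S_m) :
  (0 < n)%N ->
  exhaustion_times prof (ps_extime R prof) /\
  forall a j, ps_alloc R prof a j = eaten (prof a) (ps_extime R prof) j.
Proof.
move=> n0.
have H k : ps_inv prof (iter k (ps_step prof) (ps_init R n m)) /\
    (#|[set j | (0 < st_supply (iter k (ps_step prof) (ps_init R n m)) j)%R]|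
       <= m - k)%N.
  elim: k => [|k [IH1 IH2]].
    split; first exact: ps_inv_init.
    by rewrite subn0 -[X in (_ <= X)%N](card_ord m) max_card.
  rewrite iterS; have [I1 I2] := ps_inv_step _ _ _ _ _ n0 IH1; split=> //.
  by apply: leq_trans I2 _; rewrite subnS -!subn1 leq_sub2r.
have [[sup0 clk alc cons]] := H m.
rewrite -/(ps_run R prof) subnn leqn0 cards_eq0 => /eqP S0.
have supE j : st_supply (ps_run R prof) j = 0.
  apply/eqP; rewrite eq_le sup0 andbT leNgt.
  by have := in_set0 j; rewrite -S0 inE => ->.
have clkE j : clock (ps_run R prof) j = ps_extime R prof j.
  by rewrite /clock supE ltxx.
have alcE a j : ps_alloc R prof a j = eaten (prof a) (ps_extime R prof) j.
  rewrite /ps_alloc alc /eaten clkE; congr (Num.max 0 (_ - _)).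
  by apply: eq_bigr => j' _; rewrite clkE.
split=> //; split=> j; first by rewrite -clkE; case/andP: (clk j).
rewrite -[RHS](cons j) supE add0r; apply: eq_bigr => a _.
by rewrite -alcE.
Qed.

(** * Comparison with the run in which agent [i] is absent *)

Section RemoveAgent.
Context {R : realFieldType} {n m : nat}.
Variables (prof : 'I_n -> 'S_m) (i : 'I_n) (e e0 : 'I_m -> R).
Hypothesis e_ex : exhaustion_times prof e.
Hypothesis e0_ex : exhaustion_times (fun a : 'I_n.-1 => prof (lift i a)) e0.

Lemma sum_eatenD1 (f : 'I_m -> R) j :
  \sum_a eaten (prof a) f j = eaten (prof i) f j
    + \sum_(a < n.-1) eaten (prof (lift i a)) f j.
Proof. by rewrite (bigD1_ord i). Qed.

(* A counterexample j minimizing e0 j is impossible: every item leaving before j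
   when agent i is absent leaves no later when i is present, so the other agents
   reach j no later and j is gone by e0 j. *)
Lemma exhaustion_le j : e j <= e0 j.
Proof.
rewrite leNgt; apply/negP => lt_j.
case: (@arg_minP _ _ _ j (fun j => e0 j < e j) e0 lt_j) => j1 lt1 min1.
have [e_ge0 e_sum] := e_ex; have [e0_ge0 e0_sum] := e0_ex.
have early j' : e0 j' < e0 j1 -> e j' <= e0 j'.
  by move=> h; rewrite leNgt; apply/negP => /min1; rewrite leNgt h.
(* An agent eating [j1] when [i] is absent starts no later in the full run and, as [e0 j1 < e j1],
   gets strictly more. *)
have lt_a (a : 'I_n.-1) : start (prof (lift i a)) e0 j1 < e0 j1 ->
    eaten (prof (lift i a)) e0 j1 < eaten (prof (lift i a)) e j1.
  move=> h; rewrite eaten_eq_sub; last exact: ltW.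
  apply: lt_le_trans (le_eaten _ _ _).
  have : start (prof (lift i a)) e j1 <= start (prof (lift i a)) e0 j1; last lra.
  apply: start_le => [|j' lt_j']; first exact: start_ge0.
  have le_j' := le_start _ e0 _ _ lt_j'.
  exact: le_trans (early _ (le_lt_trans le_j' h)) le_j'.
have le_a (a : 'I_n.-1) :
    eaten (prof (lift i a)) e0 j1 <= eaten (prof (lift i a)) e j1.
  have [/lt_a/ltW //|h] := ltP (start (prof (lift i a)) e0 j1) (e0 j1).
  by rewrite eaten_eq0 // eaten_ge0.
(* Such an agent exists because the shares of [j1] sum to 1; its strict gain pushes the sum for [e]
   above 1. *)
have [/existsP [a0 a0P]|/existsPn none] :=
  boolP [exists a : 'I_n.-1, start (prof (lift i a)) e0 j1 < e0 j1]; last first.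
  have := e0_sum j1; rewrite big1 => [|a _]; first by move/eqP; rewrite eq_sym oner_eq0.
  by apply: eaten_eq0; rewrite leNgt none.
have := e_sum j1; rewrite sum_eatenD1 (bigD1 a0) //=.
have := e0_sum j1; rewrite (bigD1 a0) //=.
have le_rest : \sum_(a < n.-1 | a != a0) eaten (prof (lift i a)) e0 j1
    <= \sum_(a < n.-1 | a != a0) eaten (prof (lift i a)) e j1 by exact: ler_sum.
have := lt_a a0 a0P; have := eaten_ge0 (prof i) e j1; lra.
Qed.

Lemma start_exhaustion_le p j : start p e j <= start p e0 j.
Proof. by apply: le_bigmax2 => j' _; exact: exhaustion_le. Qed.

Definition remaining0 (T : R) (j : 'I_m) : R :=
  1 - \sum_(a < n.-1) eaten (prof (lift i a)) (fun j' => Num.min T (e0 j')) j.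

Lemma remaining0_ge0 T j : 0 <= T -> 0 <= remaining0 T j.
Proof.
move=> T0; rewrite subr_ge0 -(e0_ex.2 j); apply: ler_sum => a _.
rewrite eaten_min // ge_max eaten_ge0 /=.
apply: le_trans (le_eaten _ _ _); rewrite lerB //.
by rewrite ge_min lexx orbT.
Qed.

(** If [j] is gone by [T], the left side is 0. Otherwise the other agents start on [j] no later when
    [i] is present, so by [T] they have eaten at least as much of it. *)
Lemma remaining0_ge T j : 0 <= T ->
  1 - \sum_a eaten (prof a) (fun j' => Num.min T (e j')) j <= remaining0 T j.
Proof.
move=> T0; have [h|h] := leP (e j) T.
  rewrite (eq_bigr (fun a => eaten (prof a) e j)) => [|a _].
    by rewrite (e_ex.2 j) subrr remaining0_ge0.
  by rewrite eaten_min // min_r.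
rewrite lerB // sum_eatenD1 ler_wpDl ?eaten_ge0 //; apply: ler_sum => a _.
rewrite !eaten_min // !min_l ?(ltW h) //; last first.
  exact: le_trans (ltW h) (exhaustion_le j).
apply: le_max2 => //; rewrite lerB //; exact: start_exhaustion_le.
Qed.

(** As [j1] lasts until [T] in both runs, every agent eats exactly [T], so the totals differ by [T].
    Itemwise the difference is nonnegative, and on [P], exhausted by [T], it is what remains. *)
Lemma sum_remaining0_le (P : pred 'I_m) (T : R) (j1 : 'I_m) :
  0 <= T -> e j1 = T -> (forall j, P j -> e j <= T) ->
  \sum_(j | P j) remaining0 T j <= T.
Proof.
move=> T0 ej1 eP.
have totalE f a : T <= f j1 ->
    \sum_j eaten (prof a) (fun j' => Num.min T (f j')) j = T.
  move=> fj1; rewrite sum_eatenT; apply/eqP; rewrite eq_le; apply/andP; split.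
    by apply: bigmax_le => // j _; rewrite ge_min lexx.
  by apply: (bigmax_sup j1) => //; rewrite le_min lexx.
have T1 : T <= e0 j1 by rewrite -ej1 exhaustion_le.
pose gap j := \sum_a eaten (prof a) (fun j' => Num.min T (e j')) j
  - \sum_(a < n.-1) eaten (prof (lift i a)) (fun j' => Num.min T (e0 j')) j.
have gap_ge0 j : 0 <= gap j.
  by have := remaining0_ge T j T0; rewrite /remaining0 /gap; lra.
have -> : \sum_(j | P j) remaining0 T j = \sum_(j | P j) gap j.
  apply: eq_bigr => j Pj; rewrite /remaining0 /gap -{1}(e_ex.2 j).
  by congr (_ - _); apply: eq_bigr => a _; rewrite eaten_min // min_r // eP.
apply: (@le_trans _ _ (\sum_j gap j)).
  by rewrite [leRHS](bigID P) /= lerDl sumr_ge0.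
rewrite sumrB exchange_big [X in _ - X]exchange_big /=.
rewrite (eq_bigr (fun=> T)) => [|a _]; last by rewrite totalE ?ej1.
rewrite [X in _ - X](eq_bigr (fun=> T)) => [|a _]; last by rewrite totalE.
by rewrite (bigD1_ord i) //= addrK.
Qed.

(* While agent i eats j after time T, some other agent is eating j as well. *)
Lemma late_eaten_le T j : 0 <= T -> remaining0 T j < 1 ->
  eaten (prof i) e j
    <= eaten (prof i) (fun j' => Num.min T (e j')) j + remaining0 T j / 2.
Proof.
move=> T0 rem1; have rem0 := remaining0_ge0 T j T0.
rewrite eaten_min //; have [h|h] := leP (e j) T.
  by rewrite -/(eaten _ e j); lra.
have Te0 := le_trans (ltW h) (exhaustion_le j).
have rem0E : remaining0 T j =
    1 - \sum_(a < n.-1) Num.max 0 (T - start (prof (lift i a)) e0 j).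
  by rewrite /remaining0; congr (_ - _); apply: eq_bigr => a _; rewrite eaten_min // min_l.
(* Less than a unit remains, so some [a0] is on [j] before [T]; in the full run it eats [j] all the
   way from [T] to [e j]. *)
have [a0 a0P] : exists a : 'I_n.-1, start (prof (lift i a)) e0 j < T.
  apply/existsP; apply: contraTT rem1 => /existsPn none.
  rewrite rem0E big1 ?subr0 ?ltxx // => a _.
  by apply: max_l; rewrite subr_le0 leNgt none.
have others : \sum_(a < n.-1) Num.max 0 (T - start (prof (lift i a)) e0 j)
    + (e j - T) <= \sum_(a < n.-1) eaten (prof (lift i a)) e j.
  rewrite (bigD1 a0) //= [leRHS](bigD1 a0) //= addrAC lerD //.
    rewrite max_r; last lra.
    apply: le_trans (le_eaten _ _ _).
    have := start_exhaustion_le (prof (lift i a0)) j; lra.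
  apply: ler_sum => a _; rewrite ge_max eaten_ge0 /=.
  apply: le_trans (le_eaten _ _ _).
  have := start_exhaustion_le (prof (lift i a)) j; lra.
(* The share of [i] plus [e j - T] is at most what remains, and its part after [T] is at most
   [e j - T]; hence the half. *)
have := e_ex.2 j; rewrite sum_eatenD1 rem0E in rem0 *.
have := le_eaten (prof i) e j.
rewrite /eaten; case: (leP 0 (e j - _)); case: (leP 0 (T - _)); lra.
Qed.

End RemoveAgent.

(** * Bounding the gain from misreporting *)

(* Agent i (the paper's agent 1) has true order [prof i]; the others' reports
   are arbitrary.  Obar = its k most preferred items. *)
Theorem theorem2 (R : realFieldType) (n m k : nat) (prof : 'I_n -> 'S_m)
  (i : 'I_n) :
  (m <= n)%N -> (1 <= k)%N -> (k <= m)%N ->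
  1 / 2 <= last_ex_time R (prof i) k prof ->
  last_ex_time R (prof i) k prof < 2 / 3 ->
  forall p' : 'S_m,
    dich_util R (prof i) k (deviate prof i p') i
      <= 3 / 2 * dich_util R (prof i) k prof i.
Proof.
move=> _ k1 km Tlo Thi p'.
have n0 : (0 < n)%N := leq_ltn_trans (leq0n i) (ltn_ord i).
have [e_ex allocE] := ps_run_spec R n m prof n0.
have [e'_ex alloc'E] := ps_run_spec R n m (deviate prof i p') n0.
rewrite /last_ex_time in Tlo Thi; rewrite /dich_util.
rewrite (eq_bigr _ (fun j _ => alloc'E i j)) (eq_bigr _ (fun j _ => allocE i j)).
(* Only the truthful sum telescopes: there the order defining Obar is also the one reported. *)
rewrite sum_eaten //.
move: (ps_extime R prof) (ps_extime R (deviate prof i p')) e_ex e'_ex Tlo Thi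
  => e e' e_ex e'_ex {allocE alloc'E}.
set T := \big[_/_]_(_ | _) _ => Tlo Thi.
have T0 : 0 <= T by lra.
(* As [k >= 1], Obar contains the item of rank 0, so the maximum [T] is attained at some [j1]. *)
pose jtop : 'I_m := (prof i)^-1%g (Ordinal (leq_trans k1 km)).
have jtopP : (prof i jtop < k)%N by rewrite permKV.
have eT j : (prof i j < k)%N -> e j <= T.
  by move=> jk; apply: (le_bigmax_cond 0 e).
have [j1 _ ej1] := eq_bigmax jtop (fun j => (prof i j < k)%N) e jtopP
  (fun j _ => e_ex.1 j).
(* Without other agents, [i] alone eats a whole unit of [jtop], which forces [T >= 1]. *)
have [n1|n1] := posnP n.-1.
  have := e_ex.2 jtop; rewrite (bigD1_ord i) //= big1 => [|a _]; last first.
    by have := leq_ltn_trans (leq0n a) (ltn_ord a); rewrite [in ltnRHS]n1.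
  rewrite addr0 => eat1; have := eT jtop jtopP.
  have : eaten (prof i) e jtop <= e jtop; last lra.
  by rewrite ge_max e_ex.1 gerBl start_ge0.
have [e0_ex _] := ps_run_spec R n.-1 m (fun a => prof (lift i a)) n1.
move: (ps_extime R _) e0_ex => e0 e0_ex.
have devE (a : 'I_n.-1) : deviate prof i p' (lift i a) = prof (lift i a).
  by rewrite /deviate eq_sym (negPf (neq_lift i a)).
have e0_ex' : exhaustion_times (fun a => deviate prof i p' (lift i a)) e0.
  split=> j; first exact: e0_ex.1.
  by rewrite -[RHS](e0_ex.2 j); apply: eq_bigr => a _; rewrite devE.
have remE j : remaining0 (deviate prof i p') i e0 T j = remaining0 prof i e0 T j.
  by congr (_ - _); apply: eq_bigr => a _; rewrite devE.
have sum_rem := sum_remaining0_le prof i e e0 e_ex e0_ex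
  (fun j => (prof i j < k)%N) T j1 T0 (esym ej1) eT.
have rem_ge0 j := remaining0_ge0 prof i e0 e0_ex T j T0.
have late j : (prof i j < k)%N -> eaten (deviate prof i p' i) e' j <=
    eaten (deviate prof i p' i) (fun j' => Num.min T (e' j')) j
      + remaining0 prof i e0 T j / 2.
  move=> jk; rewrite -remE; apply: late_eaten_le => //; rewrite remE.
  (* A single remainder is bounded by the sum of these nonnegative terms, hence by [T < 2 / 3]. *)
  suff : remaining0 prof i e0 T j <= T by lra.
  by apply: le_trans sum_rem; rewrite (bigD1 j) //= lerDl sumr_ge0.
apply: le_trans (ler_sum _ late) _; rewrite big_split /= -mulr_suml.
have : \sum_(j | (prof i j < k)%N)
    eaten (deviate prof i p' i) (fun j' => Num.min T (e' j')) j <= T; last lra.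
apply: (@le_trans _ _ (\sum_j
    eaten (deviate prof i p' i) (fun j' => Num.min T (e' j')) j)).
  rewrite [leRHS](bigID (fun j => (prof i j < k)%N)) /= lerDl.
  by apply: sumr_ge0 => j _; exact: eaten_ge0.
by rewrite sum_eatenT; apply: bigmax_le => // j _; rewrite ge_min lexx.
Qed.
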